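(* Let $\mathbb{F}_q$ be a finite field with $q$ elements. For each $\epsilon>0$ there exist an infinite sequence $\omega=(f_i)_{i\in\mathbb{N}}$ of pairwise distinct polynomials in $\mathbb{F}_q[T]$, indexed so that $\deg f_i\le \deg f_j$ whenever $i<j$, and a positive integer $K'$ such that $t_h(\omega)<K'$ for all $h\in\mathbb{F}_q[T]$ and $q^{\deg f_i}\ll i^{2+\epsilon}$ (i.e. there is a constant $C>0$ with $q^{\deg f_i}\le C\, i^{2+\epsilon}$ for all $i$).
   Context: We write $f\in\omega$ if $f$ occurs in $\omega$. For $h\in\mathbb{F}_q[T]$ define $t_h(\omega)=|\{(f,g)\in\mathbb{F}_q[T]\times\mathbb{F}_q[T]: f,g\in\omega,\ h=f-g,\ \deg f,\deg g\le\deg h\}|$ (ordered pairs). Convention: $\deg 0=-\infty$, $q^{-\infty}=0$. *)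

(* Defs.v *)
From mathcomp Require Import all_boot all_order all_algebra finmap.
From mathcomp Require Import boolp classical_sets functions cardinality.
From mathcomp Require Import reals exp.

Set Implicit Arguments.
Unset Strict Implicit.
Unset Printing Implicit Defensive.

Import GRing.Theory.
Local Open Scope classical_set_scope.
Local Open Scope ring_scope.

Section Defs.
Variable F : finFieldType.
Implicit Types (f g h : {poly F}) (omega : nat -> {poly F}).

(* Degrees are compared through [size], which is [deg + 1] on nonzero
   polynomials and [0] on the zero polynomial; hence [size f <= size g] is
   [deg f <= deg g] with the convention [deg 0 = -oo]. *)
Definition deg_le f g : bool := (size f <= size g)%N.

(* [q ^ deg f], where [q ^ -oo = 0]. *)
Definition q_pow_deg f : nat := if f == 0 then 0%N else (#|F| ^ (size f).-1)%N.

Definition diff_reps omega h : set ({poly F} * {poly F}) :=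
  [set fg | [/\ range omega fg.1, range omega fg.2, h = fg.1 - fg.2,
                deg_le fg.1 h & deg_le fg.2 h]].

(* [fset_set] is the empty set on infinite sets; this lemma rules that out. *)
Lemma finite_diff_reps omega h : finite_set (diff_reps omega h).
Proof.
set m := size h.
pose to_pair (uv : {poly_m F} * {poly_m F}) : {poly F} * {poly F} :=
  (val uv.1, val uv.2).
apply: (@sub_finite_set _ _ (to_pair @` setT)); last first.
  exact: (finite_image _ finite_finset).
move=> [f g] [_ _ _ /= fh gh].
by exists (NPoly (fh : f \is a poly_of_size m),
           NPoly (gh : g \is a poly_of_size m)).
Qed.

Definition t omega h : nat := #|` fset_set (diff_reps omega h)|.

End Defs.

(* Main.v *)
Require Import Defs.
From mathcomp Require Import all_boot all_order all_algebra.
From mathcomp Require Import reals exp.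
From mathcomp Require Import finmap boolp classical_sets cardinality zify.

(* A difference of two monic polynomials of equal degree has smaller degree, so
   if [omega] consists of blocks A_k of monic polynomials of degree D (k + 3),
   only pairs from different blocks are counted by [t].  With D = 2d + 1 and
   |A_k| = q ^ (d (k + 3)), the union L_k of the earlier blocks satisfies
   |L_k| |A_k| <= q ^ (2d (k + 3)), a factor q ^ (k + 3) below the number of
   monic polynomials of the degree of A_k.  This saving allows a greedy choice
   of A_k in which every h has a number of representations f - g with f in A_k
   and g in L_k bounded independently of k.  The growth exponent is
   D / d = 2 + 1 / d. *)

Local Open Scope ring_scope.
Import Order.TTheory GRing.Theory Num.Theory.

(** * Greedy selection in a finite abelian group *)

(* Greedy choice along the potential sum_h (l + 1) ^ rep(h): averaging over the
   at least |V| / 2 unused f shows that some step increases it by at most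
   4 l |B|, so that it never exceeds 2 |V|. *)
Lemma greedy_few_differences (V : finZmodType) (B : {set V}) (l m : nat) :
  (4 * l * #|B| * m <= #|V|)%N -> (2 * m <= #|V|)%N ->
  exists2 A : {set V}, #|A| = m &
    forall h, (l.+1 ^ #|[set f in A | (f - h)%R \in B]| <= 2 * #|V|)%N.
Proof.
have [N cV] : exists N, #|V| = N by exists #|V|.
rewrite cV => lBm m2.
pose rep (A : {set V}) h := #|[set f in A | (f - h)%R \in B]|.
suff [A cA potA] : exists2 A : {set V}, #|A| = m &
    (\sum_h l.+1 ^ rep A h <= N + 4 * l * #|B| * m)%N.
  exists A => // h; rewrite -/(rep A h).
  apply: leq_trans (leq_trans (leq_addr _ _) _) (_ : N + _ <= _)%N.
    by move: potA; rewrite (bigD1 h) //=; exact.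
  by rewrite mul2n -addnn leq_add2l.
elim: m lBm m2 => [|m IHm] lBm m2.
  exists finset.set0; first by rewrite cards0.
  rewrite muln0 addn0 -cV -sum1_card leq_sum // => h _.
  by rewrite (_ : rep _ h = 0%N) //; apply: eq_card0 => f; rewrite !inE.
have [||A cA potA] := IHm; [nia|lia|].
set Phi := (\sum_h _)%N in potA.
(* [inc f] is the growth of the potential when [f] joins [A]: [rep] rises by one exactly at those
   [h] with [f - h] in [B]. *)
pose inc f := (\sum_(h | (f - h)%R \in B) l * l.+1 ^ rep A h)%N.
have sum_inc : (\sum_f inc f = l * #|B| * Phi)%N.
  rewrite /inc (exchange_big_dep predT) //= /Phi big_distrr /=.
  apply: eq_bigr => h _; rewrite sum_nat_const mulnCA mulnA.
  rewrite -(card_imset B (addIr h)); congr (_ * _ * _)%N; apply: eq_card => f.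
  rewrite unfold_in /=; apply/idP/imsetP => [fB|[g gB ->]]; last first.
    by rewrite addrK.
  by exists (f - h); rewrite ?subrK.
have [f fA incf] : exists2 f, f \notin A & (inc f <= 4 * l * #|B|)%N.
  apply/exists_inP; apply: contraT => /exists_inPn big_inc.
  have : (\sum_(f in ~: A) (4 * l * #|B|).+1 <= \sum_f inc f)%N.
    rewrite [leqRHS](bigID (mem (~: A))) /= -[leqLHS]addn0 leq_add // leq_sum //.
    by move=> f; rewrite inE => /big_inc; rewrite -ltnNge.
  rewrite sum_inc sum_nat_const; have := cardsC A; rewrite cA cV => cC.
  have cC2 : (N <= 2 * #|~: A|)%N by lia.
  (* The hypothesis on [m] keeps [Phi] at most [2 * N], so the average of [inc] over the complement
     of [A] is at most [4 * l * #|B|]. *)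
  have : (l * #|B| * Phi <= l * #|B| * (2 * N))%N by apply: leq_mul => //; nia.
  nia.
exists (f |: A); first by rewrite cardsU1 fA cA.
have repU h : rep (f |: A) h = ((f - h \in B)%R + rep A h)%N.
  rewrite /rep; case: (boolP (f - h \in B)) => fB /=.
    transitivity #|f |: [set g in A | g - h \in B]|.
      by apply: eq_card => g; rewrite !inE; case: eqP => [->|].
    by rewrite cardsU1 !inE (negPf fA).
  rewrite add0n; apply: eq_card => g; rewrite !inE.
  by case: eqP => //= ->; rewrite (negPf fB) andbF.
have -> : (\sum_h l.+1 ^ rep (f |: A) h = inc f + Phi)%N.
  rewrite /inc /Phi [X in (X + _)%N]big_mkcond -big_split; apply: eq_bigr => h _.
  by rewrite repU; case: (_ \in B); rewrite ?expnS //= mulSn addnC.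
lia.
Qed.

(** * Blocks of monic polynomials *)

(** A monic polynomial of degree [n] is ['X^n] plus a vector of [n] coefficients. Truncation to
    these coefficients is linear, so a representation of [h] yields one of [h - 'X^n] in the vector
    space, where the greedy bound applies. *)
Lemma monic_block (F : finFieldType) (n l m : nat) (L : seq {poly F}) :
  (4 * l * size L * m <= #|F| ^ n)%N -> (2 * m <= #|F| ^ n)%N ->
  exists A : seq {poly F}, [/\ size A = m, uniq A,
    forall f, f \in A -> f \is monic /\ size f = n.+1
    & forall h, (l.+1 ^ count (fun f => (f - h)%R \in L) A <= 2 * #|F| ^ n)%N].
Proof.
move=> lLm m2.
pose B := [set v : 'rV[F]_n | v \in map poly_rV L].
have cB : (#|B| <= size L)%N.
  by rewrite cardsE -(size_map (@poly_rV F n)) card_size.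
have cV : #|{: 'rV[F]_n}| = (#|F| ^ n)%N by rewrite card_mx mul1n.
have [||A cA repA] := @greedy_few_differences 'rV[F]_n B l m; rewrite ?cV //.
  by apply: leq_trans lLm; rewrite leq_mul2r leq_mul2l cB !orbT.
exists [seq 'X^n + rVpoly v | v <- enum A]; split.
- by rewrite size_map -cardE.
- rewrite map_inj_uniq ?enum_uniq // => u v /addrI /(congr1 (@poly_rV F n)).
  by rewrite !rVpolyK.
- move=> f /mapP[v _ ->].
  have lt_v : (size (rVpoly v) < size ('X^n : {poly F}))%N.
    by rewrite size_polyXn ltnS size_poly.
  by rewrite monicE lead_coefDl // lead_coefXn size_polyDl // size_polyXn.
- move=> h; rewrite -cV; apply: leq_trans (repA (poly_rV (h - 'X^n))).
  apply: leq_pexp2l => //; rewrite count_map -size_filter.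
  rewrite cardE; apply: uniq_leq_size; first by rewrite filter_uniq ?enum_uniq.
  move=> v; rewrite mem_filter mem_enum /= => /andP[vL vA].
  rewrite mem_enum !inE vA; apply/mapP; exists ('X^n + rVpoly v - h) => //.
  by rewrite -[v in LHS]rVpolyK -linearB opprB addrA [rVpoly v + _]addrC.
Qed.

(** With [l = q ^ k.+1] the potential bound forces [k.+1 * c <= D * (k + 3) + 1] for each count [c],
    whence a bound free of [k]. *)
Lemma exists_blocks (F : finFieldType) (d : nat) : (0 < d)%N ->
  let D := d.*2.+1 in
  exists A L : nat -> seq {poly F},
  [/\ L 0%N = [::], forall k, L k.+1 = L k ++ A k,
      forall k, size (A k) = (#|F| ^ (d * (k + 3)))%N /\ uniq (A k),
      forall k f, f \in A k -> f \is monic /\ size f = (D * (k + 3)).+1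
    & forall k h, (count (fun f => (f - h)%R \in L k) (A k) <= 3 * D + 1)%N].
Proof.
move=> d_gt0 D; set q := #|F|.
have q_gt1 : (1 < q)%N by apply: card_finNzRing_gt1.
have q_gt0 := ltnW q_gt1.
have leq_q a b : (a <= b)%N -> (q ^ a <= q ^ b)%N by apply: leq_pexp2l.
have double_q a : (2 * q ^ a <= q ^ a.+1)%N by rewrite expnS leq_mul2r q_gt1 orbT.
pose P (kL : nat * seq {poly F}) (A : seq {poly F}) := let: (k, L) := kL in
  [/\ size A = (q ^ (d * (k + 3)))%N, uniq A,
    forall f, f \in A -> f \is monic /\ size f = (D * (k + 3)).+1
    & (size L <= q ^ (d * (k + 3)))%N ->
      forall h, (count (fun f => (f - h)%R \in L) A <= 3 * D + 1)%N].
have /boolp.choice[next nextP] : forall kL, exists A, P kL A.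
  move=> [k L].
  (* [next] must be total, so oversized lists are replaced by the empty one. *)
  pose L' := if (size L <= q ^ (d * (k + 3)))%N then L else [::].
  have sL' : (size L' <= q ^ (d * (k + 3)))%N by rewrite /L'; case: ifP.
  have [||A [sA uA mA cA]] :=
    @monic_block F (D * (k + 3)) (q ^ k.+1) (q ^ (d * (k + 3))) L'.
  - apply: (@leq_trans (4 * q ^ k.+1 * q ^ (d * (k + 3)) * q ^ (d * (k + 3)))).
      by rewrite leq_mul2r leq_mul2l sL' !orbT.
    rewrite -!mulnA -!expnD.
    (* The offset in [k + 3] pays for the constant 4: since [4 <= q ^ 2], the exponents add up to
       exactly [D * (k + 3)]. *)
    apply: (@leq_trans (q ^ 2 * q ^ (k.+1 + (d * (k + 3) + d * (k + 3))))).
      by rewrite leq_mul2r (leq_exp2r 2 q (isT : 0 < 2)%N) q_gt1 orbT.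
    by rewrite -expnD leq_q // /D; nia.
  - by apply: leq_trans (double_q _) _; rewrite leq_q // /D; nia.
  exists A; split=> // sL h; move: (cA h); rewrite /L' sL.
  set c := count _ _ => c_le.
  have : (q ^ (k.+1 * c) <= q ^ (D * (k + 3)).+1)%N.
    apply: leq_trans (double_q _); apply: leq_trans c_le.
    by rewrite expnM; case: c => // c; rewrite leq_exp2r.
  by rewrite leq_exp2l // => ?; nia.
pose L := nat_rect (fun=> seq {poly F}) [::] (fun k L => L ++ next (k, L)).
(* Block sizes grow by the factor [q ^ d >= 2], so the earlier blocks together never outgrow the
   next one; this meets the size condition in [P]. *)
have sL k : (size (L k) <= q ^ (d * (k + 3)))%N.
  elim: k => [|k IHk] //=; rewrite size_cat.
  have [-> _ _ _] := nextP (k, L k).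
  apply: (@leq_trans (2 * q ^ (d * (k + 3)))).
    by rewrite mul2n -addnn leq_add2r.
  by apply: leq_trans (double_q _) _; rewrite leq_q //; nia.
exists (fun k => next (k, L k)), L; split=> // k; have [sA uA mA cA] := nextP (k, L k).
- by split.
- exact: mA.
- exact/cA/sL.
Qed.

(** * The infinite sequence formed by successive finite blocks *)

Section Concatenation.
Set Implicit Arguments.
Unset Strict Implicit.
Variables (T : eqType) (x0 : T) (A L : nat -> seq T).
Hypotheses (L0 : L 0%N = [::]) (LS : forall k, L k.+1 = L k ++ A k).

Lemma mem_concat k x : reflect (exists2 j, (j < k)%N & x \in A j) (x \in L k).
Proof.
apply: (iffP idP).
  elim: k => [|k IHk]; first by rewrite L0.
  rewrite LS mem_cat => /orP[/IHk[j jk xA]|xA]; last by exists k.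
  by exists j => //; apply: ltnW.
move=> [j + xA]; elim: k => // k IHk; rewrite ltnS leq_eqVlt LS mem_cat.
by case/orP => [/eqP <-|/IHk ->//]; rewrite xA orbT.
Qed.

Lemma concat_prefix j k : (j <= k)%N -> exists s, L k = L j ++ s.
Proof.
elim: k => [|k IHk].
  by rewrite leqn0 => /eqP->; exists [::]; rewrite cats0.
rewrite leq_eqVlt => /orP[/eqP->|/IHk[s Lk]].
  by exists [::]; rewrite cats0.
by exists (s ++ A k); rewrite LS Lk catA.
Qed.

Lemma leq_size_concat j k : (j <= k)%N -> (size (L j) <= size (L k))%N.
Proof. by move=> /concat_prefix[s ->]; rewrite size_cat leq_addr. Qed.

Hypothesis A_gt0 : forall k, (0 < size (A k))%N.

Lemma size_concat_ge k : (k <= size (L k))%N.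
Proof.
elim: k => // k IHk; rewrite LS size_cat.
by have := A_gt0 k; lia.
Qed.

(** With nonempty blocks, [L i.+1] has more than [i] entries, so the default [x0] is never
    reached. *)
Definition concat_nth i := nth x0 (L i.+1) i.

Lemma concat_nthE k i : (i < size (L k))%N -> concat_nth i = nth x0 (L k) i.
Proof.
move=> ik; rewrite /concat_nth.
case: (leqP k i.+1) => [|/ltnW] /concat_prefix[s ->].
  by rewrite nth_cat ik.
by rewrite nth_cat size_concat_ge.
Qed.

Lemma concat_nth_block i : exists k,
  [/\ (size (L k) <= i)%N, (i < size (L k.+1))%N & concat_nth i \in A k].
Proof.
have ex : exists k, (i < size (L k))%N by exists i.+1; apply: size_concat_ge.
(* The block sought is the last one in the shortest prefix that contains index [i]. *)
case: (ex_minnP ex) => -[|k]; first by rewrite L0.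
move=> ik k_min; have ki : (size (L k) <= i)%N.
  by rewrite leqNgt; apply/negP => /k_min; rewrite ltnn.
exists k; split=> //; rewrite (concat_nthE ik) LS nth_cat ltnNge ki /=.
by apply: mem_nth; move: ik; rewrite LS size_cat; lia.
Qed.

Lemma concat_nth_inj : (forall k, uniq (L k)) -> injective concat_nth.
Proof.
move=> uL i j; pose k := (maxn i j).+1.
have kL := size_concat_ge k.
have ik : (i < size (L k))%N by apply: leq_trans kL; rewrite ltnS leq_maxl.
have jk : (j < size (L k))%N by apply: leq_trans kL; rewrite ltnS leq_maxr.
rewrite (concat_nthE ik) (concat_nthE jk) => /eqP.
by rewrite nth_uniq // => /eqP.
Qed.

End Concatenation.

(** * Counting representations and growth *)

Lemma t_le_size (F : finFieldType) (omega : nat -> {poly F}) (h : {poly F})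
    (s : seq ({poly F} * {poly F})) :
  (forall f g, diff_reps omega h (f, g) -> (f, g) \in s) -> (t omega h <= size s)%N.
Proof.
move=> sub; apply: (@leq_trans #|` [fset x in s]%fset|).
  apply: fsubset_leq_card; apply/fsubsetP => -[f g].
  rewrite in_fset_set; last exact: finite_diff_reps.
  by rewrite !inE => /sub.
by rewrite card_fseq size_undup.
Qed.

(* [omega i] is the (i+1)-st term of the sequence, which is indexed from 1. *)
Theorem theorem1p3 (R : realType) (F : finFieldType) (eps : R)
    (eps_gt0 : 0 < eps) :
  exists (omega : nat -> {poly F}) (K : nat),
    [/\ injective omega,
        forall i j : nat, (i < j)%N -> deg_le (omega i) (omega j),
        (0 < K)%N,
        forall h : {poly F}, (t omega h < K)%N
      & exists C : R, 0 < C /\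
          forall i : nat, (q_pow_deg (omega i))%:R <= C * i.+1%:R `^ (2 + eps)].
Proof.
have [d d_gt0 d_eps] : exists2 d : nat, (0 < d)%N & d%:R^-1 <= eps.
  exists (Num.truncn eps^-1).+1 => //.
  by rewrite invf_ple ?posrE ?ltr0n //; apply/ltW; apply: truncnS_gt.
have [A [L [L0 LS sA mA cA]]] := exists_blocks F d d_gt0.
set D := d.*2.+1 in mA cA.
have q_gt1 : (1 < #|F|)%N by apply: card_finNzRing_gt1.
have A_gt0 k : (0 < size (A k))%N by have [-> _] := sA k; rewrite expn_gt0 ltnW.
have size_block_leq j k f g : f \in A j -> g \in A k -> (size f <= size g)%N = (j <= k)%N.
  by move=> /mA[_ ->] /mA[_ ->]; rewrite ltnS leq_pmul2l // leq_add2r.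
have uL k : uniq (L k).
  elim: k => [|k IHk]; first by rewrite L0.
  rewrite LS cat_uniq IHk; have [_ ->] := sA k; rewrite andbT /=.
  apply/hasPn => f fA; apply/negP => /(mem_concat L0 LS)[j jk fAj].
  by have := size_block_leq _ _ _ _ fA fAj; rewrite leqnn leqNgt jk.
pose omega := concat_nth 0 L.
have omegaP := concat_nth_block 0 L0 LS A_gt0.
(* The factor 2 accounts for whether [f] or [g] has the larger degree in a counted pair. *)
exists omega, (2 * (3 * D + 1)).+1; split=> //.
- exact: (concat_nth_inj LS A_gt0).
- move=> i j ij; have [a [ai _ wi]] := omegaP i; have [b [_ jb wj]] := omegaP j.
  rewrite /deg_le (size_block_leq _ _ _ _ wi wj) leqNgt; apply/negP => ba.
  have := leq_trans jb (leq_trans (leq_size_concat LS ba) ai).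
  by rewrite ltnNge (ltnW ij).
(* In a counted pair the member of larger degree has the degree of [h], so its block is found by
   solving [deg h = D * (k + 3)]. For other degrees no pair exists and the value of [k] is
   immaterial. *)
- move=> h; rewrite ltnS; pose k := ((size h).-1 %/ D - 3)%N.
  pose s := [seq (f, f - h) | f <- A k & f - h \in L k] ++
            [seq (g + h, g) | g <- A k & g - - h \in L k].
  apply: (@leq_trans (size s)); last first.
    rewrite size_cat !size_map !size_filter mul2n -addnn.
    by rewrite leq_add ?(cA k).
  apply: t_le_size => _ _ [/= [i _ <-] [j _ <-] hE fh gh].
  have kP a f : f \in A a -> size h = size f -> a = k.
    by move=> /mA[_ ->] hf; rewrite /k hf /= mulKn // addnK.
  have [a [_ _ fA]] := omegaP i; have [b [_ _ gA]] := omegaP j.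
  rewrite -/(omega i) in fA; rewrite -/(omega j) in gA.
  move: (omega i) (omega j) fA gA hE fh gh => f g fA gA hE.
  rewrite /deg_le => fh gh; rewrite mem_cat.
  have fg : f = g + h by rewrite hE addrC subrK.
  have gf : g = f - h by rewrite fg addrK.
  have [ab|ba|ab] := ltngtP a b.
  + have hg : size h = size g.
      rewrite hE -size_polyN opprB size_polyDl // size_polyN.
      by rewrite ltnNge (size_block_leq _ _ _ _ gA fA) -ltnNge.
    apply/orP; right; apply/mapP; exists g; last by rewrite -fg.
    rewrite mem_filter -(kP _ _ gA hg) gA andbT opprK -fg.
    by apply/(mem_concat L0 LS); exists a.
  + have hf : size h = size f.
      rewrite hE size_polyDl // size_polyN.
      by rewrite ltnNge (size_block_leq _ _ _ _ fA gA) -ltnNge.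
    apply/orP; left; apply/mapP; exists f; last by rewrite -gf.
    rewrite mem_filter -(kP _ _ fA hf) fA andbT -gf.
    by apply/(mem_concat L0 LS); exists b.
  + have [[mf sf] [mg sg]] := (mA _ _ fA, mA _ _ gA).
    suff : (size h < size f)%N by rewrite ltnNge fh.
    rewrite sf ltnS; apply/leq_sizeP => n; rewrite leq_eqVlt hE coefB.
    case/orP => [/eqP <-|n_gt].
      have := monicP mf; rewrite lead_coefE sf /= => ->.
      by have := monicP mg; rewrite lead_coefE sg -ab /= => ->; rewrite subrr.
    by rewrite !nth_default ?subrr // ?sf ?sg -?ab.
(* The constant absorbs the offset 3 in the degree [D * (k + 3)]. *)
exists (#|F| ^ (3 * D))%:R; split; first by rewrite ltr0n expn_gt0 ltnW.
move=> i; have [k [ki _ wA]] := omegaP i; rewrite -/(omega i) in wA.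
have [mw sw] := mA _ _ wA.
rewrite /q_pow_deg (negPf (monic_neq0 mw)) sw /=.
(* For positive [k], the preceding block alone already has [q ^ (d * (k + 2))] entries. *)
have qi : (#|F| ^ (d * k) <= i.+1)%N.
  case: k ki {wA sw} => [|k] ki; first by rewrite muln0.
  apply: leq_trans (leqW ki); rewrite LS size_cat; have [-> _] := sA k.
  by apply: leq_trans (leq_addl _ _); rewrite leq_exp2l // leq_mul2l addnS ltnS leq_addr orbT.
rewrite (_ : D * (k + 3) = 3 * D + D * k)%N; last by lia.
rewrite expnD natrM ler_wpM2l //.
apply: (@le_trans _ _ (i.+1%:R `^ (2 + d%:R^-1))); last first.
  by rewrite ler_powR ?lerD2l // ler1n.
apply: (@le_trans _ _ ((#|F| ^ (d * k))%:R `^ (2 + d%:R^-1))); last first.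
  by apply: ge0_ler_powR; rewrite ?nnegrE ?ler0n ?addr_ge0 ?invr_ge0 ?ler0n // ler_nat.
(* Both sides are powers of [q] with equal exponents, as [D = d * (2 + 1 / d)]. *)
rewrite !natrX -!powR_mulrn // -powRrM.
rewrite (_ : (D * k)%:R = (d * k)%:R * (2 + d%:R^-1) :> R) //.
rewrite /D -addn1 -muln2 !natrM natrD natrM [RHS]mulrAC (mulrDr d%:R 2) divff.
  by [].
by rewrite pnatr_eq0 -lt0n.
Qed.
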